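(* Let $m\leq n$ be positive integers. If $f\in\mathcal{H}_{n}$ and $g$ has a Hadamard factorization, i.e. $g=g_{1}\circ g_{2}$ for some $g_{1},g_{2}\in\mathcal{H}_{m}$, then $f\bullet g\subset\mathcal{H}_{m}$.
   Context: For an integer $k\ge 0$, $\mathbb{R}_k^+$ denotes the set of real polynomials $s\mapsto c_0+c_1s+\ldots+c_ks^k$ with all $c_i>0$ ($i=0,\ldots,k$). For $k\ge 1$, $\mathcal{H}_k$ is the set of $f\in\mathbb{R}_k^+$ all of whose complex zeros have negative real part (Hurwitz stable polynomials). Here $\circ$ denotes the Hadamard (coefficientwise) product, not composition: for $p(s)=\sum_{i=0}^m p_is^i$ and $q(s)=\sum_{i=0}^m q_is^i$ in $\mathbb{R}_m^+$, $(p\circ q)(s)=\sum_{i=0}^m p_iq_is^i$. For $f(s)=\sum_{i=0}^n a_is^i\in\mathbb{R}_n^+$ and $g(s)=\sum_{i=0}^m b_is^i\in\mathbb{R}_m^+$ with $m\le n$, the generalized Hadamard product of $f$ and $g$ is the set $f\bullet g=\{F_0,\ldots,F_{n-m}\}$, where $F_j(s)=\sum_{i=0}^m a_{j+i}b_is^i$ for $j=0,\ldots,n-m$. *)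

(* Defs.v *)
From HB Require Import structures.
From mathcomp Require Import all_boot all_order all_algebra.
From mathcomp Require Import complex.
From mathcomp Require Import classical_sets reals.

Set Implicit Arguments.
Unset Strict Implicit.
Unset Printing Implicit Defensive.

Import Order.TTheory GRing.Theory Num.Theory.
Local Open Scope ring_scope.
Local Open Scope classical_set_scope.

(* The size condition says that there are no coefficients beyond c_k;
   positivity of c_k makes the degree exactly k. *)
Definition pos_poly (R : realType) (k : nat) : set {poly R} :=
  [set p : {poly R} | (size p <= k.+1)%N /\ forall i : nat, (i <= k)%N -> 0 < p`_i].

Definition hurwitz (R : realType) (k : nat) : set {poly R} :=
  [set p : {poly R} | pos_poly k p /\
    forall z : R[i], root (map_poly (real_complex R) p) z -> complex.Re z < 0].

Definition hadamard (R : realType) (m : nat) (p q : {poly R}) : {poly R} :=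
  \poly_(i < m.+1) (p`_i * q`_i).

Definition has_hadamard_factorization (R : realType) (m : nat) (g : {poly R}) :
    Prop :=
  exists g1 g2 : {poly R},
    [/\ hurwitz m g1, hurwitz m g2 & g = hadamard m g1 g2].

(* Meant for m <= n, f of degree n and g of degree m; the degrees are passed
   explicitly. *)
Definition gen_hadamard (R : realType) (n m : nat) (f g : {poly R}) :
    set {poly R} :=
  [set \poly_(i < m.+1) (f`_(j + i) * g`_i) | j in [set j | (j <= n - m)%N]].

(* Main.v *)
(* Split f into even and odd parts, f(s) = E(s^2) + s O(s^2). If f is stable, the
   Bezoutians of (E, O) and of (x O, E) are sums of squares (induction on the
   real factors of f), so E has simple nonpositive roots and O is a nonnegative
   combination of E and of the quotients E / (x - root). The
   decomposition survives multiplication of f by s.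
   Hadamard multiplication being bilinear, these decompositions reduce the claim
   that E(f) o E(g) / O(f) o O(g) maps the upper half-plane into its closure to the
   quotients (P o xQ) / (P o Q) with P, Q having only nonpositive roots, where it
   follows from Gauss-Lucas. Hence, for f in H_n and g in H_m, f o (s^j g) cannot
   vanish at s in the open first quadrant without vanishing at -s. Since H_n is
   open, perturbing f excludes zeros in the closed right half-plane altogether,
   i.e. f . g is contained in H_m. The theorem is this result applied to g1, g2 and
   then to f, g. *)
Require Import Defs.
From HB Require Import structures.
From mathcomp Require Import all_boot all_order all_algebra.
From mathcomp Require Import complex.
From mathcomp Require Import classical_sets reals.
From mathcomp Require Import ring lra zify.

Set Implicit Arguments.
Unset Strict Implicit.
Unset Printing Implicit Defensive.

Import Order.TTheory GRing.Theory Num.Theory.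
Local Open Scope ring_scope.

Local Notation Re := (@complex.Re _).
Local Notation Im := (@complex.Im _).
Local Notation N := (@ComplexField.Normc.normc _).

(** * Complex arithmetic and the Gauss-Lucas theorem for half-planes *)

Section Complex.
Variable R : rcfType.
Implicit Types x y z : R[i].

Lemma RecD x y : Re (x + y) = Re x + Re y. Proof. by case: x; case: y. Qed.
Lemma ImcD x y : Im (x + y) = Im x + Im y. Proof. by case: x; case: y. Qed.
Lemma RecN x : Re (- x) = - Re x. Proof. by case: x. Qed.
Lemma ImcN x : Im (- x) = - Im x. Proof. by case: x. Qed.
Lemma RecM x y : Re (x * y) = Re x * Re y - Im x * Im y.
Proof. by case: x; case: y. Qed.
Lemma ImcM x y : Im (x * y) = Re x * Im y + Im x * Re y.
Proof. by case: x; case: y. Qed.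
Lemma RecC (a : R) : Re (real_complex R a) = a. Proof. by []. Qed.
Lemma ImcC (a : R) : Im (real_complex R a) = 0. Proof. by []. Qed.
Definition ReImE := (RecD, ImcD, RecN, ImcN, RecM, ImcM, RecC, ImcC).

Lemma complex_eqP x y : Re x = Re y -> Im x = Im y -> x = y.
Proof. by case: x => a b; case: y => c d /= -> ->. Qed.

Lemma sumsq_gt0 x : x != 0 -> 0 < Re x ^+ 2 + Im x ^+ 2.
Proof.
case: x => a b; rewrite eq_complex /= negb_and.
have := sqr_ge0 a; have := sqr_ge0 b => b0 a0.
by case/orP => /negPf h; [apply: ltr_pwDl|apply: ltr_wpDl] => //;
  rewrite lt_neqAle eq_sym sqrf_eq0 h /=.
Qed.

Lemma RecV x : Re x^-1 = Re x / (Re x ^+ 2 + Im x ^+ 2).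
Proof. by case: x. Qed.
Lemma ImcV x : Im x^-1 = - (Im x / (Re x ^+ 2 + Im x ^+ 2)).
Proof. by case: x. Qed.

Lemma RecV_gt0 x : 0 < Re x -> 0 < Re x^-1.
Proof.
move=> x0; rewrite RecV divr_gt0 // sumsq_gt0 //.
by apply: contraTneq x0 => ->; rewrite ltxx.
Qed.

(* The logarithmic derivative of p at t is the sum of the 1 / (t - r). *)
Lemma deriv_prod_XsubC_halfplane (u t : R[i]) (rs : seq R[i]) :
    (forall r, r \in rs -> 0 < Re (u * (t - r))) ->
  let p := \prod_(r <- rs) ('X - r%:P) in
  exists q, p^`().[t] = p.[t] * q /\ (if nilp rs then q = 0 else 0 < Re (q / u)).
Proof.
elim: rs => [|r rs IH] Hrs /=; first by exists 0; rewrite big_nil derivC horner0 mulr0.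
have [|q [dq q0]] := IH; first by move=> r' h; apply: Hrs; rewrite inE h orbT.
have r0 := Hrs r (mem_head _ _).
have utr : u * (t - r) != 0 by apply: contraTneq r0 => ->; rewrite ltxx.
have [u0 tr0] : u != 0 /\ t - r != 0 by apply/andP; rewrite -negb_or -mulf_eq0.
exists ((t - r)^-1 + q); split.
  by rewrite big_cons derivM derivXsubC hornerD !hornerM !hornerE dq; field.
have h : 0 < Re ((t - r)^-1 / u) by rewrite -invfM mulrC RecV_gt0.
rewrite mulrDl RecD; case: (rs) q0 => [->|a s q0]; last exact: addr_gt0.
by rewrite mul0r addr0.
Qed.

(** Gauss-Lucas: every root r of p has [Re (u * r) < 0], so the terms 1 / (t - r) of p' / p, divided
    by u, all have positive real part and cannot cancel. *)
Lemma deriv_halfplane_neq0 (u : R[i]) (p : {poly R[i]}) :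
    (1 < size p)%N -> (forall t, 0 <= Re (u * t) -> p.[t] != 0) ->
  forall t, 0 <= Re (u * t) -> p^`().[t] != 0.
Proof.
move=> sp hp t t0; have [rs Dp] := closed_field_poly_normal p.
have p0 : lead_coef p != 0 by rewrite lead_coef_eq0 -size_poly_gt0 ltnW.
have [r|q [dq]] := @deriv_prod_XsubC_halfplane u t rs.
  move=> rin; rewrite ltNge; apply/negP => le0.
  suff /hp : 0 <= Re (u * r).
    by rewrite Dp hornerZ mulf_eq0 negb_or p0 -rootE root_prod_XsubC rin.
  by move: le0; rewrite mulrBr !ReImE; move: t0; rewrite !ReImE; lra.
have -> : nilp rs = false.
  by move: sp; rewrite Dp size_scale // size_prod_XsubC; case: (rs).
move=> q0; have := hp t t0; set P := \prod_(r <- rs) _ in dq Dp.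
have -> : p^`() = lead_coef p *: P^`() by rewrite [in LHS]Dp derivZ.
rewrite [X in X.[t] != 0 -> _]Dp !hornerZ [X in _ -> _ * X != 0]dq.
rewrite !mulf_eq0 !negb_or => /andP[-> ->] /=.
by apply: contraTneq q0 => ->; rewrite mul0r ltxx.
Qed.

(** Gauss-Lucas passes the hypothesis on to derivatives, and coefficient i is, up to a factorial,
    the i-th derivative at 0, a point of the closed half-plane. *)
Lemma coef_halfplane_neq0 (u : R[i]) (i : nat) (p : {poly R[i]}) :
    (forall t, 0 <= Re (u * t) -> p.[t] != 0) -> (i < size p)%N -> p`_i != 0.
Proof.
elim: i p => [|i IH] p hp ip.
  by rewrite -horner_coef0; apply: hp; rewrite mulr0.
have p1 : (1 < size p)%N by lia.
have := IH _ (@deriv_halfplane_neq0 u p p1 hp).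
rewrite coef_deriv mulrn_eq0 /=; apply.
rewrite ltnNge; apply/negP => sp'.
have : lead_coef p != 0 by rewrite lead_coef_eq0 -size_poly_gt0; lia.
have: p^`()`_(size p).-2 = 0 by apply: (leq_sizeP _ _ sp'); lia.
rewrite coef_deriv lead_coefE prednK; last lia.
by move/eqP; rewrite mulrn_eq0 => /orP[/eqP|/eqP->]; [lia|rewrite eqxx].
Qed.

(** The two products are reversals of each other: both coefficients are the i-th elementary
    symmetric function of [rs]. *)
Lemma coef_prod_rev (rs : seq R) (i j : nat) : (i + j)%N = size rs ->
  (\prod_(r <- rs) (1 + r *: 'X))`_i = (\prod_(r <- rs) ('X + r%:P))`_j.
Proof.
have sz (s : seq R) : size (\prod_(r <- s) ('X + r%:P)) = (size s).+1.
  have := size_prod_XsubC s -%R; under eq_bigr do rewrite polyCN opprK.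
  by move->.
have sz1 (s : seq R) : (size (\prod_(r <- s) (1 + r *: 'X))%R <= (size s).+1)%N.
  elim: s => [|r s IH]; first by rewrite big_nil size_poly1.
  rewrite big_cons (leq_trans (size_polyMleq _ _)) //=.
  have : (size (1 + r *: 'X)%R <= 2)%N.
    rewrite (leq_trans (size_polyD _ _)) // geq_max size_poly1 /=.
    by rewrite (leq_trans (size_scale_leq _ _)) ?size_polyX.
  move=> h; rewrite -subn1 leq_subLR add1n (leq_trans (leq_add h IH)) // add2n ltnS.
elim: rs i j => [|r rs IH] i j /=.
  by rewrite !big_nil; case: i => //; case: j.
rewrite !big_cons !mulrDl !coefD !mul1r -scalerAl coefZ coefXM coefXM coefCM.
case: i j => [|i] [|j] //=; rewrite ?addSn ?addnS ?add0n ?addn0 => -[] h.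
- have -> : (\prod_(j0 <- rs) ('X + j0%:P))`_j.+1 = 0.
    by rewrite nth_default // sz h.
  by rewrite (IH 0%N j).
- have -> : (\prod_(j0 <- rs) (1 + j0 *: 'X))`_i.+1 = 0.
    by rewrite nth_default // (leq_trans (sz1 _)) // h.
  by rewrite (IH i 0%N) ?addn0.
- by rewrite (IH i.+1 j) ?(IH i j.+1) // -h ?addSn ?addnS.
Qed.
End Complex.

(** * Hadamard products with a real-rooted polynomial as coefficients of ordinary products *)

Section Hadamard.
Variable R : rcfType.
Implicit Types (x y z : R[i]) (p q : {poly R}).
Local Notation toC := (map_poly (real_complex R)).

Definition ev p z := (toC p).[z].

Lemma evD p q z : ev (p + q) z = ev p z + ev q z.
Proof. by rewrite /ev rmorphD hornerD. Qed.
Lemma evM p q z : ev (p * q) z = ev p z * ev q z.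
Proof. by rewrite /ev rmorphM hornerM. Qed.
Lemma evC (c : R) z : ev c%:P z = real_complex R c.
Proof. by rewrite /ev map_polyC hornerC. Qed.
Lemma evZ (c : R) p z : ev (c *: p) z = real_complex R c * ev p z.
Proof. by rewrite -mul_polyC evM evC. Qed.
Lemma evX z : ev 'X z = z.
Proof. by rewrite /ev map_polyX hornerX. Qed.
Lemma ev0 z : ev 0 z = 0.
Proof. by rewrite /ev rmorph0 horner0. Qed.
Lemma ev_prod (I : Type) (s : seq I) (F : I -> {poly R}) z :
  ev (\prod_(i <- s) F i) z = \prod_(i <- s) ev (F i) z.
Proof. by rewrite /ev rmorph_prod horner_prod. Qed.
Definition evE := (evD, evM, evZ, evX, evC).

Lemma ev_real p (a : R) : ev p (real_complex R a) = real_complex R p.[a].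
Proof. by rewrite /ev horner_map. Qed.

Lemma ev_conj p z : ev p (conjc z) = conjc (ev p z).
Proof.
rewrite /ev -[in RHS]horner_map -map_poly_comp; congr horner.
by apply: eq_map_poly => a /=; rewrite oppr0.
Qed.

Definition had p q := \poly_(i < size p) (p`_i * q`_i).

Lemma coef_had p q i : (had p q)`_i = p`_i * q`_i.
Proof.
rewrite coef_poly; case: ltnP => // ip.
by rewrite (nth_default _ ip) mul0r.
Qed.

Lemma hadC p q : had p q = had q p.
Proof. by apply/polyP => i; rewrite !coef_had mulrC. Qed.
Lemma hadDl p q r : had (p + q) r = had p r + had q r.
Proof. by apply/polyP => i; rewrite !(coef_had, coefD) mulrDl. Qed.
Lemma hadDr p q r : had r (p + q) = had r p + had r q.
Proof. by rewrite hadC hadDl !(hadC r). Qed.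
Lemma hadZl c p q : had (c *: p) q = c *: had p q.
Proof. by apply/polyP => i; rewrite !(coef_had, coefZ) mulrA. Qed.
Lemma hadZr c p q : had p (c *: q) = c *: had p q.
Proof. by rewrite hadC hadZl hadC. Qed.
Lemma had0r p : had p 0 = 0.
Proof. by apply/polyP => i; rewrite coef_had coef0 mulr0. Qed.
Lemma had0l p : had 0 p = 0.
Proof. by rewrite hadC had0r. Qed.
Lemma hadMX p q : had (p * 'X) (q * 'X) = had p q * 'X.
Proof.
by apply/polyP => -[|i]; rewrite !(coef_had, coefMX) //= mulr0.
Qed.

Lemma coef_comp_scaleX (h : {poly R[i]}) x i :
  (h \Po (x *: 'X))`_i = h`_i * x ^+ i.
Proof.
rewrite comp_polyE.
under eq_bigr do rewrite exprZn scalerA.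
rewrite -(poly_def _ (fun i => h`_i * x ^+ i)) coef_poly.
by case: ltnP => // ih; rewrite (nth_default _ ih) mul0r.
Qed.

(** Reversing one factor turns the termwise sum of the Hadamard product into the convolution sum of
    an ordinary product, to which Gauss-Lucas applies. *)
Lemma coef_rev_comp (ts : seq R) p x :
  (toC (\prod_(t <- ts) (1 + t *: 'X)) * (toC p \Po (x *: 'X)))`_(size ts) =
  ev (had (\prod_(t <- ts) ('X + t%:P)) p) x.
Proof.
set P := \prod_(t <- ts) ('X + t%:P).
have sP : size P = (size ts).+1.
  by have := size_prod_XsubC ts -%R; under eq_bigr do rewrite polyCN opprK.
rewrite coefMr /ev (@horner_coef_wide _ (size ts).+1); last first.
  by rewrite size_map_poly -sP size_poly.
apply: eq_bigr => i _; rewrite coef_comp_scaleX !coef_map coef_had /=.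
rewrite (@coef_prod_rev _ ts _ i) ?subnK -1?ltnS //.
by rewrite rmorphM mulrA.
Qed.

(** The upper half-plane is tilted slightly, so as to keep x and w while also taking in the positive
    reals. *)
Lemma exists_rotation (x w : R[i]) : 0 < Im x -> 0 < Im w ->
  exists2 e : R, 0 < e & 0 < Im x + e * Re x /\ 0 < Im w + e * Re w.
Proof.
move=> x0 w0; pose e := Num.min (Im x / (1 + `|Re x|)) (Im w / (1 + `|Re w|)).
have p1 (a : R) : 0 < 1 + `|a| by rewrite ltr_pwDl.
have aux (a b : R) : 0 < a -> 0 < e -> e <= a / (1 + `|b|) -> 0 < a + e * b.
  move=> a0 e0; rewrite ler_pdivlMr // => h.
  have : - (e * `|b|) <= e * b.
    by rewrite -mulrN ler_pM2l // lerNl -normrN ler_norm.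
  by lra.
have e0 : 0 < e by rewrite lt_min !divr_gt0.
by exists e => //; split; apply: aux => //; rewrite ge_min lexx ?orbT.
Qed.

(* Otherwise w := - beta / alpha lies in the upper half-plane, and
   w * alpha + beta is a coefficient of the product of the 1 + t X, of the
   f + x X and of w + x X, whose nonzero roots all lie in one open half-plane;
   by Gauss-Lucas no such coefficient vanishes. *)
Lemma had_prodX_interlace (ts fs : seq R) x
    (P : {poly R} := \prod_(t <- ts) ('X + t%:P)) (Q : {poly R} := \prod_(t <- fs) ('X + t%:P))
    (alpha : R[i] := ev (had P Q) x) (beta : R[i] := ev (had P (Q * 'X)) x) :
    {in ts, forall t : R, 0 <= t} -> {in fs, forall t : R, 0 <= t} -> 0 < Im x ->
  0 <= Im beta * Re alpha - Re beta * Im alpha.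
Proof.
move=> ts0 fs0 x0; rewrite leNgt; apply/negP => ab.
have al0 : alpha != 0 by apply: contraTneq ab => -> /=; rewrite !mulr0 subrr ltxx.
pose w := - beta / alpha.
have wE : w * alpha + beta = 0 by rewrite /w; field.
have w0 : 0 < Im w.
  have n0 := sumsq_gt0 al0.
  rewrite /w ImcM RecV ImcV ImcN RecN.
  have -> : - Re beta * - (Im alpha / (Re alpha ^+ 2 + Im alpha ^+ 2)) +
     - Im beta * (Re alpha / (Re alpha ^+ 2 + Im alpha ^+ 2)) =
     - (Im beta * Re alpha - Re beta * Im alpha) / (Re alpha ^+ 2 + Im alpha ^+ 2).
    by field; rewrite lt0r_neq0.
  by rewrite divr_gt0 // oppr_gt0.
have [e e0 [xe we]] := exists_rotation x0 w0.
(* [Re (y * v) = Im y + e * Re y] is positive for y = x, y = w and real y > 0. Each nonzero root t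
   of the product has [u * t = - (y * v)], where y is a positive multiple of x, a positive real, or
   w. *)
pose v : R[i] := Complex e (-1); pose u := x * v.
have xn0 : x != 0 by apply: contraTneq x0 => ->; rewrite ltxx.
pose A := toC (\prod_(t <- ts) (1 + t *: 'X)).
pose H := toC Q \Po (x *: 'X).
have AE t : A.[t] = \prod_(r <- ts) (1 + real_complex R r * t).
  rewrite -[LHS]/(ev _ t) ev_prod; apply: eq_bigr => r _.
  by rewrite evD evZ evX evC rmorph1.
have HE t : H.[t] = \prod_(r <- fs) (x * t + real_complex R r).
  rewrite /H horner_comp -[LHS]/(ev _ _) ev_prod; apply: eq_bigr => r _.
  by rewrite !evE !hornerE.
have S0 : (A * H)`_(size ts) = alpha by exact: coef_rev_comp.
have S1 : (A * (H * (x *: 'X)))`_(size ts) = beta.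
  rewrite /beta /P -coef_rev_comp rmorphM /= map_polyX /H.
  by rewrite comp_polyM comp_polyX.
(* A zero entry of [fs] gives a root at 0, on the boundary of the half-plane; the power of X is
   split off and the coefficient index drops by k. *)
have [k [q q0 Sq]] := multiplicity_XsubC (A * H) 0.
have AH0 : A * H != 0 by apply: contraNneq al0 => AH0; rewrite -S0 AH0 coef0.
move: q0; rewrite AH0 /= => q0.
rewrite subr0 in Sq.
have kd : (k <= size ts)%N.
  rewrite leqNgt; apply/negP => dk; move: al0.
  by rewrite -S0 Sq coefMXn dk eqxx.
pose T := q * (w%:P + x *: 'X).
have Td : T`_(size ts - k) = 0.
  have -> : T`_(size ts - k) = (T * 'X^k)`_(size ts) by rewrite coefMXn ltnNge kd.
  have -> : T * 'X^k = w *: (A * H) + A * (H * (x *: 'X)).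
    rewrite mulrA Sq /T -!mul_polyC; set X := polyC x; set W := polyC w; ring.
  by rewrite coefD coefZ S0 S1.
have sT : (size ts - k < size T)%N.
  have : (size ts - k < size q)%N.
    rewrite ltnNge; apply/negP => le; move: al0.
    by rewrite -S0 Sq coefMXn ltnNge kd /= (nth_default _ le) eqxx.
  have sx : size (w%:P + x *: 'X) = 2.
    by rewrite addrC size_polyDl size_scale ?size_polyX // size_polyC; case: eqP.
  rewrite /T size_mul ?sx ?addn2 //=; last by rewrite -size_poly_eq0 sx.
    by move=> /leqW.
  by apply: contraNneq q0 => ->; rewrite root0.
suff /coef_halfplane_neq0 /(_ sT) : forall t, 0 <= Re (u * t) -> T.[t] != 0.
  by rewrite Td eqxx.
move=> t t0; rewrite /T hornerM mulf_neq0 //.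
  have [-> //|tn0] := eqVneq t 0.
  apply: contraTneq t0 => qt.
  have : (A * H).[t] = 0 by rewrite Sq hornerM qt mul0r.
  rewrite hornerM AE HE => /eqP; rewrite mulf_eq0 -ltNge.
  case/orP; rewrite prodf_seq_eq0 => /hasP[r rin /= /eqP E].
    have r0 := ts0 _ rin.
    have rn : 0 < r.
      rewrite lt_neqAle r0 andbT; apply: contra_eq_neq E => <-.
      by rewrite rmorph0 mul0r addr0 oner_neq0.
    have -> : t = real_complex R (- r^-1).
      rewrite rmorphN fmorphV; apply: (@mulfI _ (real_complex R r)).
        by rewrite fmorph_eq0 lt0r_neq0.
      rewrite mulrN divff ?fmorph_eq0 ?lt0r_neq0 //.
      by apply/eqP; rewrite -subr_eq0 opprK addrC E.
    rewrite /u !ReImE /= mulr0 subr0 mulrN oppr_lt0.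
    by rewrite mulr_gt0 ?invr_gt0 //; lra.
  have r0 := fs0 _ rin.
  have ut : u * t = - (real_complex R r * v).
    by apply/eqP; rewrite -subr_eq0 opprK /u -[X in _ == X](mul0r v) -E; apply/eqP; ring.
  have rn : 0 < r.
    rewrite lt_neqAle r0 andbT; apply: contra_eq_neq E => <-.
    by rewrite rmorph0 addr0 mulf_neq0.
  by rewrite ut !ReImE /= mul0r subr0 oppr_lt0 mulr_gt0.
rewrite !hornerE; apply: contraTneq t0 => E; rewrite -ltNge.
have -> : u * t = - (w * v).
  by apply/eqP; rewrite -subr_eq0 opprK /u -[X in _ == X](mul0r v) -E; apply/eqP; ring.
by clearbody w; rewrite !ReImE /=; lra.
Qed.
End Hadamard.

(** * Quotients of Hadamard products on the upper half-plane *)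

Section Interlacing.
Variable R : rcfType.
Implicit Types (p q U V W E O : {poly R}) (z : R[i]).

(* Im (U z * conj (V z)) >= 0, i.e. U / V maps the upper half-plane to its closure. *)
Definition upper U V := forall z, 0 < Im z ->
  0 <= Im (ev U z) * Re (ev V z) - Re (ev U z) * Im (ev V z).

Lemma upper_refl U : upper U U.
Proof. by move=> z _; rewrite mulrC subrr. Qed.
Lemma upper0r U : upper U 0.
Proof. by move=> z _; rewrite ev0 /= !mulr0 subrr. Qed.

Lemma upperDr U V W c : 0 <= c -> upper U V -> upper U W -> upper U (c *: V + W).
Proof.
move=> c0 hV hW z z0; rewrite !evE !ReImE !mul0r subr0 addr0.
by have := mulr_ge0 c0 (hV z z0); have := hW z z0; lra.
Qed.
Lemma upperD U V W : upper V U -> upper W U -> upper (V + W) U.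
Proof.
by move=> hV hW z z0; rewrite !evE !ReImE; have := hV z z0; have := hW z z0; lra.
Qed.
Lemma upperZ U V c : 0 <= c -> upper V U -> upper (c *: V) U.
Proof.
move=> c0 hV z z0; rewrite !evE !ReImE !mul0r subr0 addr0.
by have := mulr_ge0 c0 (hV z z0); lra.
Qed.
Lemma upperX U : upper (U * 'X) U.
Proof.
move=> z z0; rewrite !evE !ReImE.
set a := Re (ev U z); set b := Im (ev U z).
have := mulr_ge0 (ltW z0) (addr_ge0 (sqr_ge0 a) (sqr_ge0 b)); lra.
Qed.

Definition nonpos_rooted p := exists (c : R) (ts : seq R),
  {in ts, forall t : R, 0 <= t} /\ p = c *: \prod_(t <- ts) ('X + t%:P).

Lemma nonpos_rootedM p (t : R) : 0 <= t -> nonpos_rooted p ->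
  nonpos_rooted (p * ('X + t%:P)).
Proof.
move=> t0 [c [ts [ts0 ->]]]; exists c, (t :: ts); split.
  by move=> r; rewrite inE => /orP[/eqP->|/ts0].
by rewrite big_cons -scalerAl; congr (_ *: _); rewrite mulrC.
Qed.

Lemma nonpos_rootedMX p : nonpos_rooted p -> nonpos_rooted (p * 'X).
Proof. by move=> /(nonpos_rootedM (lexx 0)); rewrite polyC0 addr0. Qed.

Lemma upper_hadX p q : nonpos_rooted p -> nonpos_rooted q ->
  upper (had p (q * 'X)) (had p q).
Proof.
move=> [c [ts [ts0 ->]]] [d [fs [fs0 ->]]] z z0.
rewrite -scalerAl !(hadZl, hadZr) !scalerA !evZ !ReImE !mul0r !subr0 !addr0.
have := mulr_ge0 (sqr_ge0 (c * d)) (had_prodX_interlace ts0 fs0 z0); lra.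
Qed.

(** The quotients W / U are the building blocks 1 and 1 / (x + t) of a partial fraction
    expansion. *)
Definition deflation U W := W = U \/
  exists t, [/\ 0 <= t, nonpos_rooted W & U = W * ('X + t%:P)].

(** If both deflations are proper, multiplying out X + s and X + t leaves four terms, settled by
    [upperX], [upper_hadX] (twice) and [upper_refl]. *)
Lemma upper_deflation E U O V : nonpos_rooted E -> nonpos_rooted U ->
  deflation E O -> deflation U V -> upper (had E U) (had O V).
Proof.
have shift p q t : 0 <= t -> nonpos_rooted p -> nonpos_rooted q ->
    upper (had p (q * ('X + t%:P))) (had p q).
  move=> t0 hp hq; rewrite mulrDr [q * t%:P]mulrC mul_polyC hadDr hadZr addrC.
  by apply: upperD; [apply: upperZ => //; exact: upper_refl|exact: upper_hadX].
move=> hE hU [->|[s [s0 hO ->]]] [->|[t [t0 hV ->]]].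
- exact: upper_refl.
- exact: shift.
- by rewrite hadC (hadC O); apply: shift.
rewrite !mulrDr ![_ * _%:P]mulrC !mul_polyC !hadDl !hadDr !hadZl !hadZr hadMX.
apply: upperD; apply: upperD; do ?apply: upperZ => //.
- exact: upperX.
- by rewrite hadC (hadC O); apply: upper_hadX.
- exact: upper_hadX.
- exact: upper_refl.
Qed.

(** Encodes V / U = c + sum of c_t / (x + t) with nonnegative coefficients, free of division and
    ready for induction on the terms. *)
Inductive interlace U : {poly R} -> Prop :=
| interlace0 : interlace U 0
| interlace_cons c W V :
    0 <= c -> deflation U W -> interlace U V -> interlace U (c *: W + V).

Lemma interlaceMX U V : interlace U V -> interlace (U * 'X) (V * 'X).
Proof.
elim=> [|c W {}V c0 UW _ IH]; first by rewrite mul0r; exact: interlace0.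
rewrite mulrDl -scalerAl; apply: interlace_cons => //.
case: UW => [->|[t [t0 hW ->]]]; first by left.
by right; exists t; split=> //; [exact: nonpos_rootedMX|rewrite mulrAC].
Qed.

(** [had] is bilinear and [upper] is closed under nonnegative combinations on the right, so single
    terms suffice. *)
Lemma upper_interlace E U O V : nonpos_rooted E -> nonpos_rooted U ->
  interlace E O -> interlace U V -> upper (had E U) (had O V).
Proof.
move=> hE hU EO UV; elim: EO => [|c W {}O c0 EW _ IH].
  by rewrite had0l; exact: upper0r.
rewrite hadDl hadZl; apply: upperDr => // {IH}.
elim: UV => [|d Y {}V d0 UY _ IH]; first by rewrite had0r; exact: upper0r.
rewrite hadDr hadZr; apply: upperDr => //; exact: upper_deflation.
Qed.
End Interlacing.

(** * Bezoutians of the even and odd parts of a stable polynomial *)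

Section Bezoutian.
Variable R : rcfType.
Implicit Types (f p q U V W E O : {poly R}) (a b z : R[i]) (K : R[i] -> R[i] -> R[i]).

(** Without conjugation the kernels obey polynomial identities; at a = conj b the sum becomes that
    of the |h(b)|^2, since each h is real. *)
Definition sum_of_squares K := exists hs : seq {poly R},
  forall a b, K a b = \sum_(h <- hs) ev h a * ev h b.

Lemma sos0 : sum_of_squares (fun _ _ => 0).
Proof. by exists [::] => a b; rewrite big_nil. Qed.

Lemma sos1 p : sum_of_squares (fun a b => ev p a * ev p b).
Proof. by exists [:: p] => a b; rewrite big_seq1. Qed.

Lemma sosD K1 K2 : sum_of_squares K1 -> sum_of_squares K2 ->
  sum_of_squares (fun a b => K1 a b + K2 a b).
Proof.
move=> [hs1 h1] [hs2 h2]; exists (hs1 ++ hs2) => a b.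
by rewrite big_cat /= h1 h2.
Qed.

Lemma sosM p K : sum_of_squares K ->
  sum_of_squares (fun a b => ev p a * ev p b * K a b).
Proof.
move=> [hs h]; exists [seq p * h | h <- hs] => a b.
rewrite big_map h mulr_sumr; apply: eq_bigr => g _; rewrite !evM; ring.
Qed.

Lemma sosZ (c : R) K : 0 <= c -> sum_of_squares K ->
  sum_of_squares (fun a b => real_complex R c * K a b).
Proof.
move=> c0 /(sosM (Num.sqrt c)%:P) [hs h]; exists hs => a b.
by rewrite -h !evC -rmorphM -expr2 sqr_sqrtr.
Qed.

(* The Bezoutian (U b * V a - U a * V b) / (b - a) is positive semidefinite. *)
Definition bezout_psd U V := exists2 K, sum_of_squares K &
  forall a b, ev U b * ev V a - ev U a * ev V b = (b - a) * K a b.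

Definition halfplane_stable f := forall z, 0 <= Re z -> ev f z != 0.

(** This is (X - z)(X - conj z), written with real coefficients. *)
Definition conj_quadratic z :=
  'X * 'X + (- (2 * Re z) *: 'X + (Re z ^+ 2 + Im z ^+ 2)%:P).

Lemma size_conj_quadratic z : size (conj_quadratic z) = 3.
Proof.
rewrite /conj_quadratic -expr2 size_polyDl size_polyXn // ltnS.
rewrite (leq_trans (size_polyD _ _)) // geq_max.
by rewrite (leq_trans (size_scale_leq _ _)) ?size_polyX // (leq_trans (size_polyC_leq1 _)).
Qed.

Lemma ev_conj_quadratic z y : ev (conj_quadratic z) y = (y - z) * (y - conjc z).
Proof.
by case: z => c d; apply: complex_eqP; rewrite !evE !ReImE /=; ring.
Qed.

(** The remainder is real of degree at most 1, so vanishing at a nonreal z kills it. *)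
Lemma conj_quadratic_dvd f z : Im z != 0 -> ev f z = 0 -> conj_quadratic z %| f.
Proof.
move=> z0 fz; set q := conj_quadratic z.
have sq : size q = 3 := size_conj_quadratic z.
have qz : ev q z = 0 by rewrite ev_conj_quadratic subrr mul0r.
have q0 : q != 0 by rewrite -size_poly_eq0 sq.
have : ev (f %% q) z = 0.
  by have := fz; rewrite {1}(divp_eq f q) evD evM qz mulr0 add0r.
have := ltn_modpN0 f q0; rewrite sq ltnS => sr.
rewrite /dvdp /ev; set r := f %% q in sr *.
rewrite (@horner_coef_wide _ 2) ?size_map_poly //.
rewrite !big_ord_recl big_ord0 !coef_map /= expr0 mulr1 expr1 addr0 => e.
have i0 : r`_1 = 0.
  move: (congr1 Im e); rewrite !ReImE /= !(mul0r, add0r, addr0) => /eqP.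
  by rewrite mulf_eq0 (negPf z0) orbF => /eqP.
have r0 : r`_0 = 0 by move: (congr1 Re e); rewrite !ReImE /= i0 !(mul0r, addr0, subr0).
apply/eqP/polyP => -[|[|i]]; rewrite ?r0 ?i0 coef0 //.
by rewrite nth_default // (leq_trans sr).
Qed.

(** A real root or a conjugate pair is split off. The two Bezoutians are carried together because
    each new one is a nonnegative combination of squares and of both old ones, possibly multiplied
    by squares. *)
Lemma bezout_psd_stable f : halfplane_stable f ->
  bezout_psd (even_poly f) (odd_poly f) /\
  bezout_psd (odd_poly f * 'X) (even_poly f).
Proof.
have [n] := ubnP (size f); elim: n f => // n IH f sf fS.
have [f1|f1] := leqP (size f) 1.
  rewrite (size1_polyC f1) even_polyC odd_polyC.
  by split; exists (fun _ _ => 0); do ?exact: sos0; move=> a b; rewrite !(ev0, evM); ring.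
have /closed_rootP[z] : size (map_poly (real_complex R) f) != 1.
  by rewrite size_map_poly; case: ltngtP f1.
move=> /eqP fz; have zn : Re z < 0.
  by rewrite ltNge; apply/negP => /fS; rewrite /ev fz eqxx.
have f0 : f != 0 by rewrite -size_poly_gt0 ltnW.
have [z0|z0] := eqVneq (Im z) 0.
  have zE : z = real_complex R (Re z) by apply: complex_eqP.
  have /factor_theorem[g Df] : root f (Re z).
    apply/eqP; apply: (@complexI R); rewrite rmorph0 -ev_real -zE; exact: fz.
  pose r := - Re z; have r0 : 0 <= r by rewrite oppr_ge0 ltW.
  have {}Df : f = g * 'X + r *: g by rewrite Df -mul_polyC /r polyCN; ring.
  have [||[K1 S1 h1] [K2 S2 h2]] := IH g.
  - have gX0 : g * ('X + r%:P) != 0 by rewrite mulrDr [g * r%:P]mulrC mul_polyC -Df.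
    have g0 : g != 0 by apply: contraNneq gX0 => ->; rewrite mul0r.
    rewrite -ltnS (leq_trans _ sf) // ltnS Df -mul_polyC mulrC -mulrDl.
    by rewrite size_mul // -?size_poly_eq0 size_XaddC.
  - move=> y y0; have := fS y y0; rewrite Df !evE.
    by apply: contraNneq => ->; rewrite mul0r mulr0 addr0.
  rewrite Df even_polyD odd_polyD even_polyMX odd_polyMX even_polyZ odd_polyZ.
  move: (even_poly g) (odd_poly g) h1 h2 => E O h1 h2; split.
    (* The even and odd parts of (X + r) g are x O + r E and E + r O; the kernel results from
       expanding their Bezoutian. *)
    exists (fun a b => real_complex R (r ^+ 2) * K1 a b +
        (K2 a b + real_complex R r * (ev O a * ev O b))).
      apply: sosD; first by apply: sosZ => //; exact: sqr_ge0.
      by apply: sosD => //; apply: sosZ => //; exact: sos1.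
    by move=> a b; rewrite !mulrDr mulrCA -h1 -h2 !evE rmorphXn /=; ring.
  exists (fun a b => real_complex R r * (ev E a * ev E b) +
      (ev 'X a * ev 'X b * K1 a b + real_complex R (r ^+ 2) * K2 a b)).
    apply: sosD; first by apply: sosZ => //; exact: sos1.
    by apply: sosD; [exact: sosM|apply: sosZ => //; exact: sqr_ge0].
  move=> a b; rewrite !mulrDr [(b - a) * (_ * K1 a b)]mulrCA.
  by rewrite [(b - a) * (_ * K2 a b)]mulrCA -h1 -h2 !evE rmorphXn /=; ring.
have := conj_quadratic_dvd z0 fz; rewrite dvdp_eq; move: (f %/ _) => g /eqP Df.
pose p := - (2 * Re z); pose c := Re z ^+ 2 + Im z ^+ 2.
have p0 : 0 <= p by rewrite /p; lra.
have c0 : 0 <= c by rewrite addr_ge0 ?sqr_ge0.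
have Dg : f = g * 'X * 'X + (p *: (g * 'X) + c *: g).
  by rewrite Df /conj_quadratic -/p -/c -!mul_polyC; ring.
have [||[K1 S1 h1] [K2 S2 h2]] := IH g.
- have g0 : g != 0 by apply: contraNneq f0 => g0; rewrite Df g0 mul0r.
  have sq := size_conj_quadratic z.
  have q0 : conj_quadratic z != 0 by rewrite -size_poly_eq0 sq.
  by rewrite -ltnS (leq_trans _ sf) // ltnS Df size_mul // sq addnS addn2 /= ltnS leqnSn.
- move=> y y0; have := fS y y0; rewrite Df !evM.
  by apply: contraNneq => ->; rewrite mul0r.
rewrite Dg !(even_polyD, odd_polyD, even_polyMX, odd_polyMX, even_polyZ, odd_polyZ).
move: (even_poly g) (odd_poly g) h1 h2 => E O h1 h2; clearbody p c; split.
  (* The parts of (X^2 + p X + c) g are (x + c) E + p x O and (x + c) O + p E. *)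
  exists (fun a b => ev ('X + c%:P) a * ev ('X + c%:P) b * K1 a b +
      (real_complex R p * (ev E a * ev E b) +
       (real_complex R (p * c) * (ev O a * ev O b) + real_complex R (p ^+ 2) * K2 a b))).
    apply: sosD; first exact: sosM.
    apply: sosD; first by apply: sosZ => //; exact: sos1.
    apply: sosD; first by apply: sosZ; [exact: mulr_ge0|exact: sos1].
    by apply: sosZ => //; exact: sqr_ge0.
  move=> a b; rewrite !mulrDr [(b - a) * (_ * K1 a b)]mulrCA.
  by rewrite [(b - a) * (_ * K2 a b)]mulrCA -h1 -h2 !evE rmorphXn rmorphM /=; ring.
exists (fun a b => ev ('X + c%:P) a * ev ('X + c%:P) b * K2 a b +
    (real_complex R p * (ev (O * 'X) a * ev (O * 'X) b) +
     (real_complex R (p * c) * (ev E a * ev E b) +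
      real_complex R (p ^+ 2) * (ev 'X a * ev 'X b * K1 a b)))).
  apply: sosD; first exact: sosM.
  apply: sosD; first by apply: sosZ => //; exact: sos1.
  apply: sosD; first by apply: sosZ; [exact: mulr_ge0|exact: sos1].
  by apply: sosZ; [exact: sqr_ge0|exact: sosM].
move=> a b; rewrite !mulrDr [(b - a) * (_ * K2 a b)]mulrCA.
rewrite [(b - a) * (_ * (_ * K1 a b))]mulrCA [(b - a) * (_ * K1 a b)]mulrCA.
by rewrite -h1 -h2 !evE rmorphXn rmorphM /=; ring.
Qed.
End Bezoutian.

(** * Partial fractions from a positive semidefinite Bezoutian *)

Section PartialFractions.
Variable R : rcfType.
Implicit Types (p q U V W : {poly R}) (a b z : R[i]) (r : R) (rs : seq R).

(** The [size p] distinct candidates d / (k + 1) outnumber the roots. *)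
Lemma exists_small_nonroot (p : {poly R[i]}) (d : R) : p != 0 -> 0 < d ->
  exists2 e : R, 0 < e <= d & p.[real_complex R e] != 0.
Proof.
move=> p0 d0; pose s := [seq d / k.+1%:R | k <- iota 0 (size p)].
have su : uniq s.
  rewrite map_inj_uniq ?iota_uniq // => i j /(mulfI (lt0r_neq0 d0)) /invr_inj /eqP.
  by rewrite eqr_nat => /eqP[].
have /allPn[e es ne] : ~~ all (fun e => root p (real_complex R e)) s.
  apply/negP => h; have /eqP := p0; apply.
  apply: (@roots_geq_poly_eq0 _ _ [seq real_complex R e | e <- s]).
  - by rewrite all_map.
  - by rewrite map_inj_uniq //; exact: complexI.
  - by rewrite !size_map size_iota.
exists e => //; move/mapP: es => [k _ ->].
by rewrite divr_gt0 //= ler_piMr ?(ltW d0) // invf_le1 // ler1n.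
Qed.

Lemma ev_eq0 p : (forall z, ev p z = 0) -> p = 0.
Proof.
move=> h; apply/eqP/contraT; rewrite -(map_poly_eq0 (real_complex R)) => p0.
by have [e _] := exists_small_nonroot p0 ltr01; rewrite -[X in X != 0]/(ev p _) h eqxx.
Qed.

Lemma nonneg_coef_root_le0 U r : (forall i, 0 <= U`_i) -> U != 0 -> U.[r] = 0 -> r <= 0.
Proof.
move=> h U0 Ur; rewrite leNgt; apply/negP => r0; have /eqP := Ur; apply/negP.
rewrite lt0r_neq0 // horner_coef.
have lt : ((size U).-1 < size U)%N by rewrite prednK ?size_poly_gt0.
rewrite (bigD1 (Ordinal lt)) //= ltr_pwDl //; last first.
  by apply: sumr_ge0 => i _; rewrite mulr_ge0 // exprn_ge0 // ltW.
by rewrite mulr_gt0 ?exprn_gt0 // lt_neqAle h andbT eq_sym -lead_coefE lead_coef_eq0.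
Qed.

Lemma nonpos_rooted_prod (c : R) rs : {in rs, forall r : R, r <= 0} ->
  nonpos_rooted (c *: \prod_(r <- rs) ('X - r%:P)).
Proof.
move=> rs0; exists c, [seq - r | r <- rs]; split.
  by move=> _ /mapP[r /rs0 r0 ->]; rewrite oppr_ge0.
by rewrite big_map; under [in RHS]eq_bigr do rewrite polyCN.
Qed.

Section Bezout.
Variables U V : {poly R}.
Hypotheses (U0 : U != 0) (UV : bezout_psd U V).
Hypothesis coprimeUV : forall z, ev U z = 0 -> ev V z != 0.

(** At a nonreal root z the kernel K(conj z, z) is 0 and equals the sum of the |h(z)|^2, so every h
    vanishes at z. Then K(z, b) = 0 and U(b) V(z) = 0 for all b, against coprimality. *)
Lemma bezout_psd_real_root z : ev U z = 0 -> Im z = 0.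
Proof.
move=> Uz; apply/eqP/contraT => z0; case: UV => K [hs hK] Kab.
have zz : z - conjc z != 0.
  by apply: contraNneq z0 => /(congr1 Im); rewrite ImcD ImcN; case: (z) => c d /=; lra.
have : K (conjc z) z = 0.
  apply: (mulfI zz); by rewrite -Kab !ev_conj Uz conjc0 !mul0r subrr mulr0.
rewrite hK => /eqP; rewrite psumr_eq0; last first.
  by move=> h _; rewrite ev_conj mulrC mulcJ_ge0.
move=> /allP hs0.
have hz h : h \in hs -> ev h z = 0.
  move=> /hs0 /=; rewrite ev_conj mulf_eq0 conjc_eq0 orbb => /eqP//.
suff : U = 0 by move/eqP: U0.
apply: ev_eq0 => b; apply/eqP; rewrite -[_ == _]orbF -(negPf (coprimeUV Uz)) -mulf_eq0.
have := Kab z b; rewrite Uz mul0r subr0 hK big_seq big1 ?mulr0 => [->//|h /hz->].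
by rewrite mul0r.
Qed.

(** Setting a = r gives V(r) W = sum of h(r) h, hence V(r) W(r) = sum of h(r)^2. If this were 0, all
    h(r) and then W would vanish. *)
Lemma bezout_psd_residue_gt0 W r : U = W * ('X - r%:P) -> 0 < W.[r] * V.[r].
Proof.
move=> UW; case: UV => K [hs hK] Kab.
have Ur : ev U (real_complex R r) = 0.
  by rewrite ev_real UW hornerM hornerXsubC subrr mulr0 rmorph0.
have Vr : V.[r] != 0 by have := coprimeUV Ur; rewrite ev_real fmorph_eq0.
have WE : V.[r] *: W = \sum_(h <- hs) h.[r] *: h.
  apply/eqP; rewrite -subr_eq0 -[_ == 0]orFb -(polyXsubC_eq0 r) -mulf_eq0; apply/eqP.
  apply: ev_eq0 => b; have := Kab (real_complex R r) b.
  rewrite Ur mul0r subr0 hK UW -polyCN !evE rmorphN !ev_real.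
  have -> : ev (- \sum_(h <- hs) h.[r] *: h) b =
      - \sum_(h <- hs) ev h (real_complex R r) * ev h b.
    rewrite -scaleN1r evZ rmorphN1 mulN1r; congr (- _).
    rewrite /ev rmorph_sum horner_sum; apply: eq_bigr => h _.
    by rewrite -[LHS]/(ev _ b) evZ -ev_real.
  by move=> e; rewrite mulrDr mulrN -e; ring.
have : V.[r] * W.[r] = \sum_(h <- hs) h.[r] ^+ 2.
  rewrite -hornerZ WE horner_sum; apply: eq_bigr => h _.
  by rewrite hornerZ expr2.
rewrite mulrC => ->; rewrite lt_neqAle sumr_ge0 ?andbT; last by move=> h _; exact: sqr_ge0.
rewrite eq_sym psumr_eq0; last by move=> h _; exact: sqr_ge0.
apply/negP => /allP hs0; have /eqP := U0; apply; rewrite UW.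
suff -> : W = 0 by rewrite mul0r.
apply/eqP; rewrite -[_ == _]orFb -(negPf Vr) -scaler_eq0 WE big_seq big1 // => h /hs0.
by rewrite /= sqrf_eq0 => /eqP ->; rewrite scale0r.
Qed.

(** All roots are real, and a double root r would make W(r) = 0 for W = U / (X - r), against the
    strict positivity of W(r) V(r). *)
Lemma bezout_psd_factor : exists2 rs, uniq rs &
  U = lead_coef U *: \prod_(r <- rs) ('X - r%:P).
Proof.
have [zs Dz] := closed_field_poly_normal (map_poly (real_complex R) U).
have zsR z : z \in zs -> z = real_complex R (Re z).
  move=> zin; apply: complex_eqP => //=; apply: bezout_psd_real_root.
  rewrite /ev Dz hornerZ; apply/eqP; rewrite mulf_eq0; apply/orP; right.
  by rewrite -rootE root_prod_XsubC.
have UE : U = lead_coef U *: \prod_(r <- map Re zs) ('X - r%:P).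
  apply: (@map_poly_inj _ _ (real_complex R)); rewrite Dz lead_coef_map /=.
  rewrite -[X in _ = _ X]mul_polyC rmorphM /= map_polyC /= mul_polyC; congr (_ *: _).
  rewrite rmorph_prod big_map; apply: eq_big_seq => z /zsR zE /=.
  by rewrite rmorphB /= map_polyX map_polyC /= -zE.
exists (map Re zs) => //; apply: count_mem_uniq => r; set rs := map Re zs in UE *.
case: (boolP (r \in rs)) => [rin|/count_memPn//].
have pr := perm_to_rem rin; rewrite (permP pr) /= eqxx.
suff /count_memPn -> : r \notin rem r rs by [].
apply/negP => rin'.
have := @bezout_psd_residue_gt0 (lead_coef U *: \prod_(s <- rem r rs) ('X - s%:P)) r.
rewrite hornerZ.
have -> : (\prod_(s <- rem r rs) ('X - s%:P)).[r] = 0.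
  by apply/eqP; rewrite -rootE root_prod_XsubC.
rewrite mulr0 mul0r ltxx => h.
suff /h : U = lead_coef U *: \prod_(s <- rem r rs) ('X - s%:P) * ('X - r%:P) by [].
by rewrite {1}UE (perm_big _ pr) big_cons /= -scalerAl mulrC.
Qed.

Hypotheses (coefU : forall i, 0 <= U`_i) (coefV : forall i, 0 <= V`_i).
Hypothesis sizeUV : (size V <= size U)%N.

Lemma bezout_psd_interlace : nonpos_rooted U /\ interlace U V.
Proof.
have [rs urs UE] := bezout_psd_factor.
have lU : lead_coef U != 0 by rewrite lead_coef_eq0.
have Urs r : (r \in rs) = (U.[r] == 0).
  by rewrite {1}UE hornerZ mulf_eq0 (negPf lU) /= -rootE root_prod_XsubC.
have rs0 : {in rs, forall r : R, r <= 0}.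
  by move=> r; rewrite Urs => /eqP; exact: nonneg_coef_root_le0.
have hU : nonpos_rooted U by rewrite UE; exact: nonpos_rooted_prod.
split=> //.
have sU : size U = (size rs).+1 by rewrite UE size_scale // size_prod_XsubC.
pose W r := lead_coef U *: \prod_(s <- rem r rs) ('X - s%:P).
have UW r : r \in rs -> U = W r * ('X - r%:P).
  move=> rin; rewrite {1}UE (perm_big _ (perm_to_rem rin)) big_cons /=.
  by rewrite /W -scalerAl mulrC.
have sW r : r \in rs -> size (W r) = size rs.
  move=> rin; rewrite size_scale // size_prod_XsubC size_rem // prednK //.
  by case: (rs) rin.
(* [c r] is the residue of V / U at r, and [k] below is the value of V / U at infinity. *)
pose c r := V.[r] / (W r).[r].
have c0 r : r \in rs -> 0 <= c r.
  move=> rin; have := bezout_psd_residue_gt0 (UW r rin); rewrite /c => h.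
  have w0 : (W r).[r] != 0 by apply: contraTneq h => ->; rewrite mul0r ltxx.
  have -> : V.[r] / (W r).[r] = ((W r).[r] * V.[r]) / (W r).[r] ^+ 2 by field.
  by rewrite divr_ge0 ?sqr_ge0 // ltW.
pose k := V`_(size rs) / lead_coef U.
have VE : V = k *: U + \sum_(r <- rs) c r *: W r.
  (* Lagrange interpolation: the difference vanishes on [rs] and has degree below the number of
     these roots. *)
  apply/eqP; rewrite -subr_eq0; apply/eqP; apply: (@roots_geq_poly_eq0 _ _ rs) => //.
    apply/allP => r rin; rewrite rootE hornerD hornerN hornerD hornerZ.
    have := rin; rewrite Urs => /eqP ->; rewrite mulr0 add0r horner_sum.
    rewrite (bigD1_seq r) //= big1_seq ?addr0 => [|s /andP[sr sin]].
      rewrite hornerZ /c divfK ?subrr //.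
      by have := bezout_psd_residue_gt0 (UW r rin); apply: contraTneq => ->; rewrite mul0r ltxx.
    rewrite hornerZ; apply/eqP; rewrite mulf_eq0; apply/orP; right.
    have := rin; rewrite Urs {1}(UW s sin) hornerM hornerXsubC mulf_eq0 subr_eq0.
    by case/orP => // /eqP rs'; rewrite rs' eqxx in sr.
  apply/leq_sizeP => j hj; rewrite coefB coefD coefZ coef_sum.
  rewrite big1_seq ?addr0 => [|r /= rin]; last by rewrite coefZ nth_default ?mulr0 // sW.
  move: hj; rewrite leq_eqVlt => /orP[/eqP <-|hj].
    have -> : U`_(size rs) = lead_coef U by rewrite lead_coefE sU.
    by rewrite /k divfK ?subrr.
  by rewrite !nth_default ?mulr0 ?subrr ?sU // (leq_trans sizeUV) ?sU.
rewrite VE; apply: interlace_cons; [|by left|].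
  by rewrite divr_ge0 // lead_coefE.
(* The induction runs over a sublist, while the [rs] inside [W] and [c] stays fixed. *)
have : {subset rs <= rs} by [].
elim: {1 3}rs => [|r s IH] sub; first by rewrite big_nil; exact: interlace0.
have rin : r \in rs by apply: sub; rewrite mem_head.
rewrite big_cons; apply: interlace_cons; [exact: c0| |apply: IH => x xs; apply: sub].
  right; exists (- r); rewrite oppr_ge0 rs0 // polyCN; split; [by []| |exact: UW].
  by apply: nonpos_rooted_prod => s' /mem_rem; exact: rs0.
by rewrite inE xs orbT.
Qed.
End Bezout.
End PartialFractions.

(** * Zeros of Hadamard products of stable polynomials *)

Section StableHadamard.
Variable R : rcfType.
Implicit Types (f g p q : {poly R}) (s z : R[i]).

Lemma ev_even_odd f s :
  ev f s = ev (even_poly f) (s ^+ 2) + s * ev (odd_poly f) (s ^+ 2).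
Proof.
rewrite -[in LHS](poly_even_odd f) evD evM evX mulrC [s * _]mulrC.
by rewrite /ev !map_comp_poly !horner_comp /= map_polyXn hornerXn mulrC.
Qed.

(** Both pairs (E, O) and (x O, E) are recorded because the second is the pair of parts of f X; this
    gives closure under multiplication by X. *)
Definition even_odd_interlace f :=
  [/\ nonpos_rooted (even_poly f), interlace (even_poly f) (odd_poly f),
      nonpos_rooted (odd_poly f * 'X) & interlace (odd_poly f * 'X) (even_poly f)].

Lemma even_odd_interlaceMX f : even_odd_interlace f -> even_odd_interlace (f * 'X).
Proof.
move=> [hE EO hO OE]; split; rewrite ?even_polyMX ?odd_polyMX //.
  exact: nonpos_rootedMX.
exact: interlaceMX.
Qed.

Lemma stable_even_odd_interlace f n : (0 < n)%N -> (size f <= n.+1)%N ->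
  (forall i, (i <= n)%N -> 0 < f`_i) -> halfplane_stable f -> even_odd_interlace f.
Proof.
move=> n0 sf fpos fS.
have coef0 i : (n < i)%N -> f`_i = 0 by move=> ni; rewrite nth_default // (leq_trans sf).
have coef_ge0 i : 0 <= f`_i.
  by have [/fpos/ltW//|/coef0->] := leqP i n.
have coef_neq0 i : f`_i != 0 -> (i <= n)%N.
  by apply: contraR; rewrite -ltnNge => /coef0 ->.
have size_gt p i : p`_i != 0 -> (i < size p)%N.
  by apply: contraR; rewrite -leqNgt => h; rewrite nth_default.
have [bEO bOE] := bezout_psd_stable fS.
(* A common root z would make f vanish at both square roots of z, one of which has nonnegative real
   part. *)
have cop z : ev (even_poly f) z = 0 -> ev (odd_poly f) z != 0.
  move=> Ez; apply/negP => /eqP Oz.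
  have h s : s ^+ 2 = z -> ev f s = 0 by move=> sz; rewrite ev_even_odd sz Ez Oz mulr0 addr0.
  have [/fS|s0] := leP 0 (Re (sqrtc z)); first by rewrite h ?sqr_sqrtc // eqxx.
  have /fS : 0 <= Re (- sqrtc z) by rewrite RecN; lra.
  by rewrite h ?sqrrN ?sqr_sqrtc // eqxx.
have E0 : even_poly f != 0.
  have /size_gt : (even_poly f)`_0 != 0 by rewrite coef_even_poly lt0r_neq0 ?fpos.
  by rewrite size_poly_gt0.
have sO : (1 < size (odd_poly f * 'X)%R)%N.
  by apply: size_gt; rewrite coefMX coef_odd_poly lt0r_neq0 ?fpos.
have O0 : odd_poly f * 'X != 0 by rewrite -size_poly_gt0 ltnW.
have [|||hE EO] := bezout_psd_interlace E0 bEO cop.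
- by move=> i; rewrite coef_even_poly.
- by move=> i; rewrite coef_odd_poly.
- apply/leq_sizeP => j; apply: contraTeq; rewrite coef_odd_poly -ltnNge => /coef_neq0 jn.
  by apply: size_gt; rewrite coef_even_poly lt0r_neq0 // fpos // ltnW.
have copX z : ev (odd_poly f * 'X) z = 0 -> ev (even_poly f) z != 0.
  rewrite evM evX => /eqP; rewrite mulf_eq0 => /orP[/eqP Oz|/eqP ->].
    by apply/negP => /eqP/cop; rewrite Oz eqxx.
  rewrite -(rmorph0 (real_complex R)) ev_real fmorph_eq0 horner_coef0 coef_even_poly.
  by rewrite lt0r_neq0 ?fpos.
have [|||hO OE] := bezout_psd_interlace O0 bOE copX.
- by move=> [|i]; rewrite coefMX ?coef_odd_poly /=.
- by move=> i; rewrite coef_even_poly.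
- apply/leq_sizeP => j; apply: contraTeq; rewrite coef_even_poly -ltnNge => /coef_neq0.
  case: j => [|j] jn; first exact: ltnW.
  apply: size_gt; rewrite coefMX coef_odd_poly lt0r_neq0 // fpos //.
  by rewrite (leq_trans _ jn) // doubleS.
by split.
Qed.

(** Let A and C be the even and odd parts of the product at s^2, which lies in the upper half-plane.
    A zero at s means A = - s C, so Im (A conj C) = - Im s |C|^2; as this is nonnegative, A = C =
    0. *)
Lemma had_root_opp f g s : even_odd_interlace f -> even_odd_interlace g ->
  0 < Re s -> 0 < Im s -> ev (had f g) s = 0 -> ev (had f g) (- s) = 0.
Proof.
move=> [fE fEO _ _] [gE gEO _ _] s0 s1; rewrite (ev_even_odd _ s) (ev_even_odd _ (- s)) sqrrN.
have -> : even_poly (had f g) = had (even_poly f) (even_poly g).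
  by apply/polyP => i; rewrite !(coef_had, coef_even_poly).
have -> : odd_poly (had f g) = had (odd_poly f) (odd_poly g).
  by apply/polyP => i; rewrite !(coef_had, coef_odd_poly).
have z0 : 0 < Im (s ^+ 2) by rewrite expr2 ImcM; have := mulr_gt0 s0 s1; lra.
have := upper_interlace fE gE fEO gEO z0.
move: (ev _ _) (ev _ _) => C A + AC.
have {}AC : A = - (s * C) by apply/eqP; rewrite -addr_eq0 AC.
have [C0 _|C0] := eqVneq C 0; first by rewrite AC C0; ring.
move=> up; exfalso; have := mulr_gt0 s1 (sumsq_gt0 C0).
by move: up; rewrite AC !ReImE; lra.
Qed.
End StableHadamard.

(** * Openness of the set of stable polynomials *)

Section Openness.
Variable R : rcfType.
Implicit Types (f p q : {poly R}) (s z : R[i]).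

Lemma normc_ge0 z : 0 <= N z.
Proof. by case: z => a b; rewrite sqrtr_ge0. Qed.

Lemma ler_Re_normc z : `|Re z| <= N z.
Proof.
by case: z => a b; rewrite -sqrtr_sqr ler_sqrt ?addr_ge0 ?sqr_ge0 // lerDl sqr_ge0.
Qed.

Lemma normc_real (a : R) : N (real_complex R a) = `|a|.
Proof. by rewrite /= expr0n addr0 sqrtr_sqr. Qed.

Lemma normcXn z k : N (z ^+ k) = N z ^+ k.
Proof.
elim: k => [|k IH]; first by rewrite !expr0 ComplexField.Normc.normc1.
by rewrite !exprS ComplexField.Normc.normcM IH.
Qed.

(** The power of 1 + |s| matches the growth of a perturbation of the same degree, so the bound works
    on the whole unbounded half-plane. *)
Lemma prod_XsubC_lower_bound (rs : seq R[i]) : {in rs, forall r, Re r < 0} ->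
  exists2 c : R, 0 < c & forall s, 0 <= Re s ->
    c * (1 + N s) ^+ size rs <= N (\prod_(r <- rs) (s - r)).
Proof.
elim: rs => [|r rs IH] rs0.
  by exists 1 => // s _; rewrite big_nil ComplexField.Normc.normc1 mulr1.
have [c c0 hc] := IH (fun r' h => rs0 r' (mem_behead (h : r' \in behead (r :: rs)))).
have r0 : Re r < 0 by apply: rs0; rewrite mem_head.
(* Combining |s - r| >= - Re r with |s| <= |s - r| + |r| yields |s - r| >= e (1 + |s|). *)
have Nr := normc_ge0 r; pose e := - Re r / (1 + N r - Re r).
have e0 : 0 < e by rewrite divr_gt0; lra.
exists (e * c) => [|s s0]; first exact: mulr_gt0.
rewrite big_cons ComplexField.Normc.normcM /= exprS mulrACA.
have Ns := normc_ge0 s.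
apply: ler_pM (hc s s0); try by rewrite mulr_ge0 ?exprn_ge0 ?ltW //; lra.
rewrite /e mulrAC ler_pdivrMr; last by lra.
have h1 : - Re r <= N (s - r).
  have := ler_Re_normc (s - r); have := ler_norm (Re (s - r)).
  by rewrite RecD RecN; lra.
have h2 : N s <= N (s - r) + N r by have := le_normcD (s - r) r; rewrite subrK.
nra.
Qed.

Lemma ev_upper_bound p (n : nat) (d : R) s : (size p <= n.+1)%N ->
  (forall i, `|p`_i| <= d) -> N (ev p s) <= d * n.+1%:R * (1 + N s) ^+ n.
Proof.
move=> sp pd; rewrite /ev (@horner_coef_wide _ n.+1) ?size_map_poly //.
have Ns := normc_ge0 s; have T1 : 1 <= 1 + N s by lra.
have tri (F : 'I_n.+1 -> R[i]) : N (\sum_i F i) <= \sum_i N (F i).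
  elim/big_rec2: _ => [|i x y _ h]; first by rewrite ComplexField.Normc.normc0.
  by rewrite (le_trans (le_normcD _ _)) // lerD2l.
apply: le_trans (tri _) _.
have -> : d * n.+1%:R * (1 + N s) ^+ n = \sum_(i < n.+1) d * (1 + N s) ^+ n.
  by rewrite sumr_const card_ord -mulr_natr; ring.
apply: ler_sum => i _; rewrite ComplexField.Normc.normcM coef_map normc_real normcXn.
apply: ler_pM => //; rewrite ?exprn_ge0 //.
apply: (@le_trans _ _ ((1 + N s) ^+ i)); first by rewrite lerXn2r ?nnegrE; lra.
by apply: ler_weXn2l => //; rewrite -ltnS.
Qed.

Lemma halfplane_stable_open f (n : nat) : size f = n.+1 -> halfplane_stable f ->
  exists2 d : R, 0 < d & forall p, (size p <= n.+1)%N -> (forall i, `|p`_i| <= d) ->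
    halfplane_stable (f + p).
Proof.
move=> sf fS; have [rs Df] := closed_field_poly_normal (map_poly (real_complex R) f).
have f0 : lead_coef f != 0 by rewrite lead_coef_eq0 -size_poly_eq0 sf.
have l0 : lead_coef (map_poly (real_complex R) f) != 0 by rewrite lead_coef_map fmorph_eq0.
have srs : size rs = n.
  by move: sf; rewrite -(size_map_poly (real_complex R)) Df size_scale // size_prod_XsubC => -[].
have [|c c0 hc] := @prod_XsubC_lower_bound rs.
  move=> r rin; rewrite ltNge; apply/negP => /fS /eqP; apply.
  by rewrite /ev Df hornerZ; apply/eqP; rewrite mulf_eq0 -rootE root_prod_XsubC rin orbT.
have a0 : 0 < `|lead_coef f| by rewrite normr_gt0.
(* Makes the upper bound for |p(s)| half of the lower bound for |f(s)|. *)
pose d := `|lead_coef f| * c / (2 * n.+1%:R).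
have n0 : 0 < n.+1%:R :> R by rewrite ltr0n.
have d0 : 0 < d by rewrite divr_gt0 ?mulr_gt0.
exists d => // p sp pd s s0; rewrite evD; apply/negP => /eqP e.
have Nfp : N (ev f s) = N (ev p s).
  by rewrite -normcN; congr N; apply/eqP; rewrite eq_sym -addr_eq0 addrC e.
have := ev_upper_bound s sp pd; rewrite -Nfp.
have Ns := normc_ge0 s.
have T0 : 0 < (1 + N s) ^+ n by rewrite exprn_gt0 // ltr_pwDl.
rewrite /ev Df hornerZ ComplexField.Normc.normcM lead_coef_map normc_real.
rewrite horner_prod; under eq_bigr do rewrite hornerXsubC.
have := ler_wpM2l (ltW a0) (hc s s0); rewrite srs => h1 h2.
have := le_trans h1 h2.
have -> : d * n.+1%:R = `|lead_coef f| * c / 2.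
  by rewrite /d; field; rewrite lt0r_neq0 // addrC natr1.
have := mulr_gt0 (mulr_gt0 a0 c0) T0; move: ((1 + N s) ^+ n) (`|lead_coef f|).
by clear=> T a; lra.
Qed.

Lemma positive_lower_bound (a : nat -> R) (n : nat) :
    (forall i, (i <= n)%N -> 0 < a i) ->
  exists2 c, 0 < c & forall i, (i <= n)%N -> c <= a i.
Proof.
elim: n => [|n IH] h; first by exists (a 0%N); [exact: h|case].
have [|c c0 hc] := IH; first by move=> i hi; apply: h; exact: leqW.
exists (Num.min c (a n.+1)) => [|i]; first by rewrite lt_min c0 h.
by rewrite ge_min leq_eqVlt => /orP[/eqP->|/hc->] //; rewrite lexx orbT.
Qed.

Lemma coef_bound p : exists2 c : R, 0 <= c & forall i, `|p`_i| <= c.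
Proof.
exists (\sum_(i < size p) `|p`_i|); first exact: sumr_ge0.
move=> i; have [ip|ip] := ltnP i (size p); last first.
  by rewrite nth_default // normr0 sumr_ge0.
by rewrite (bigD1 (Ordinal ip)) //= lerDl sumr_ge0.
Qed.
End Openness.

(** * Stability of the polynomials F_j *)

Section SegmentProduct.
Variable R : realType.
Implicit Types (f g p : {poly R}) (s z : R[i]).

Definition segment_had (m j : nat) f g := \poly_(i < m.+1) (f`_(j + i) * g`_i).

Lemma even_odd_interlaceMXn f j :
  even_odd_interlace f -> even_odd_interlace (f * 'X^j).
Proof.
move=> h; elim: j => [|j IH]; first by rewrite mulr1.
by rewrite exprSr mulrA; exact: even_odd_interlaceMX.
Qed.

Lemma hurwitz_halfplane_stable n f : hurwitz n f -> halfplane_stable f.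
Proof.
by move=> [_ h] z z0; apply/negP => fz; have := h z fz; rewrite ltNge z0.
Qed.

Lemma hurwitz_size n f : hurwitz n f -> size f = n.+1.
Proof.
move=> [[sf fpos] _]; apply/eqP; rewrite eqn_leq sf /= ltnNge; apply/negP => h.
by have := fpos n (leqnn n); rewrite (nth_default _ h) ltxx.
Qed.

(** Moving the conjugate pair of roots by e costs only O(e) in the coefficients. *)
Lemma conj_quadratic_shift z (e : R) :
  conj_quadratic (z + real_complex R e) =
  conj_quadratic z + e *: ((2 * Re z)%:P - 2 *: 'X + e%:P).
Proof.
rewrite /conj_quadratic !ReImE addr0 -!mul_polyC !(polyCD, polyCN, polyCM, rmorphXn, polyC_exp) /=.
ring.
Qed.

(* A zero z of F := segment_had m j f g with Re z >= 0 < Im z can be moved to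
   z + e by a small change of the coefficients of F, hence of f, so that f stays
   stable; had_root_opp then forces the modified F to vanish at - z - e as well,
   which fails for suitable e. *)
Lemma segment_had_upper_root n m j f g z : (0 < m)%N -> (j + m <= n)%N ->
  hurwitz n f -> hurwitz m g -> 0 <= Re z -> 0 < Im z ->
  ev (segment_had m j f g) z != 0.
Proof.
move=> m0 jmn fH gH z0 z1; set F := segment_had m j f g.
have [[sf fpos] _] := fH; have [[sg gpos] _] := gH.
have Fpos i : (i <= m)%N -> 0 < F`_i.
  move=> im; rewrite coef_poly ltnS im mulr_gt0 ?gpos // fpos //.
  by rewrite (leq_trans _ jmn) // leq_add2l.
have sF : (size F <= m.+1)%N by exact: size_poly.
apply/negP => /eqP Fz.
have := conj_quadratic_dvd (lt0r_neq0 z1) Fz; rewrite dvdp_eq.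
set F1 := F %/ _ => /eqP FE.
have F10 : F1 != 0.
  by apply: contraTneq (Fpos 0%N isT) => F10; rewrite FE F10 mul0r coef0 ltxx.
have sF1 : ((size F1).+2 <= m.+1)%N.
  rewrite (leq_trans _ sF) // [in X in (_ <= X)%N]FE size_mul // ?size_conj_quadratic ?addn3 //.
  by rewrite -size_poly_eq0 size_conj_quadratic.
have [d d0 dS] := halfplane_stable_open (hurwitz_size fH) (hurwitz_halfplane_stable fH).
have [mf mf0 mfP] := positive_lower_bound fpos.
have [mg mg0 mgP] := positive_lower_bound gpos.
pose G1 := F1 * ((2 * Re z)%:P - 2 *: 'X).
have [K1 K10 K1P] := coef_bound G1; have [K2 K20 K2P] := coef_bound F1.
(* The bound [d] keeps the perturbed f stable, and [mf / 2] keeps its coefficients positive. *)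
pose d' := Num.min d (mf / 2).
have d'0 : 0 < d' by rewrite lt_min d0 divr_gt0.
(* With e <= 1, the change e G1 + e^2 F1 has coefficients at most e (K1 + K2), hence at most d' mg,
   which leaves d' after division by those of g. *)
pose e1 := Num.min 1 (d' * mg / (K1 + K2 + 1)).
have K0 : 0 < K1 + K2 + 1 by lra.
have e10 : 0 < e1 by rewrite lt_min ltr01 divr_gt0 // mulr_gt0.
(* Sends e to - (z + e), so that a nonroot e of the composite keeps F1 from vanishing there. *)
pose shift : {poly R[i]} := (-1) *: 'X + (- z)%:P.
have sshift : size shift = 2.
  rewrite size_polyDl size_scale ?size_polyX ?oppr_eq0 ?oner_eq0 //.
  by rewrite size_polyC; case: eqP.
have [||e /andP[e0 ee1] Fe] := @exists_small_nonroot R (map_poly (real_complex R) F1 \Po shift) e1.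
- by rewrite comp_poly2_eq0 // map_poly_eq0.
- by [].
have {}Fe : ev F1 (- (z + real_complex R e)) != 0.
  have -> : - (z + real_complex R e) = shift.[real_complex R e].
    by rewrite /shift !hornerE; ring.
  by rewrite /ev -horner_comp.
set s := z + real_complex R e in Fe.
have s0 : 0 < Re s by rewrite /s RecD /= ltr_wpDl.
have s1 : 0 < Im s by rewrite /s ImcD /= addr0.
(* Q is F with the roots z and conj z moved to s and conj s; now Re s > 0 even if z was
   imaginary. *)
pose Q := F1 * conj_quadratic s; pose D := Q - F.
have DE : D = e *: G1 + e ^+ 2 *: F1.
  rewrite /D /Q FE /s conj_quadratic_shift /G1 -!mul_polyC rmorphXn /=; ring.
have sD : (size D <= m.+1)%N.
  rewrite (leq_trans (size_polyD _ _)) // size_polyN geq_max sF andbT.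
  by rewrite (leq_trans (size_polyMleq _ _)) // size_conj_quadratic addn3.
have QE : Q = F + D by rewrite /D addrC subrK.
clearbody D; have Dsmall i : (i <= m)%N -> `|D`_i / g`_i| <= d'.
  move=> im; have g0 := gpos i im.
  rewrite normrM normfV (gtr0_norm g0) ler_pdivrMr //.
  apply: le_trans (_ : d' * mg <= _); last by rewrite ler_pM2l // mgP.
  have e_1 : e <= 1 by rewrite (le_trans ee1) // ge_min lexx.
  have e_2 : e * (K1 + K2 + 1) <= d' * mg.
    by rewrite -ler_pdivlMr // (le_trans ee1) // ge_min lexx orbT.
  apply: le_trans e_2; rewrite DE coefD !coefZ.
  rewrite (le_trans (ler_normD _ _)) // [X in X + _]normrM [X in _ + X]normrM
    (gtr0_norm e0) (gtr0_norm (exprn_gt0 2 e0)).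
  have h1 : e * `|G1`_i| <= e * K1 by rewrite ler_pM2l.
  have h2 : e ^+ 2 * `|F1`_i| <= e * K2.
    rewrite expr2 -mulrA ler_pM2l //; apply: le_trans (K2P i).
    by rewrite ler_piMl.
  by move: (e * `|_|) (e ^+ 2 * `|_|) h1 h2 => a b; nra.
(* Dividing by the coefficients of g lifts the change D of F to a change of f. *)
pose p := \poly_(k < n.+1) (if (j <= k <= j + m)%N then D`_(k - j) / g`_(k - j) else 0).
have psmall k : `|p`_k| <= d'.
  rewrite coef_poly; case: ifP => _; last by rewrite normr0 ltW.
  case: ifP => [/andP[jk km]|_]; last by rewrite normr0 ltW.
  by apply: Dsmall; rewrite leq_subLR.
have fpS : halfplane_stable (f + p).
  apply: dS => [|i]; first exact: size_poly.
  by rewrite (le_trans (psmall i)) // ge_min lexx.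
have fpI : even_odd_interlace (f + p).
  apply: (@stable_even_odd_interlace _ _ n) => //.
  - by rewrite (leq_trans m0) // (leq_trans _ jmn) // leq_addl.
  - by rewrite (leq_trans (size_polyD _ _)) // geq_max sf size_poly.
  - move=> i hi; rewrite coefD.
    have := ler_norm (- p`_i); rewrite normrN => h.
    have := le_trans h (psmall i); have : d' <= mf / 2 by rewrite ge_min lexx orbT.
    by have := mfP i hi; lra.
have gI : even_odd_interlace (g * 'X^j).
  apply: even_odd_interlaceMXn; apply: (@stable_even_odd_interlace _ _ m) => //.
  exact: hurwitz_halfplane_stable gH.
have hE : had (f + p) (g * 'X^j) = Q * 'X^j.
  apply/polyP => k; rewrite coef_had !coefMXn; case: ltnP => jk; first by rewrite mulr0.
  rewrite QE !coefD; have [km|km] := leqP (k - j) m; last first.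
    have big r : (size r <= m.+1)%N -> r`_(k - j) = 0 :> R.
      by move=> sr; rewrite nth_default // (leq_trans sr).
    by rewrite (big g) // (big F) // (big D) // mulr0 addr0.
  have kjm : (k <= j + m)%N by rewrite -leq_subLR.
  rewrite mulrDl [p`_k]coef_poly ltnS (leq_trans kjm jmn) jk kjm /= divfK ?lt0r_neq0 ?gpos //.
  by rewrite [F`_ _]coef_poly ltnS km subnKC.
have evXn w : ev ('X^j) w = w ^+ j by rewrite /ev map_polyXn hornerXn.
(* The value of Q X^j at - s is the product of F1(- s), - 2 s, - 2 Re s and (- s)^j, all nonzero. *)
have := had_root_opp fpI gI s0 s1; rewrite hE !evM evXn !ev_conj_quadratic subrr.
rewrite mul0r mulr0 mul0r => /(_ erefl) /eqP; apply/negP.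
have sn0 : - s != 0 by rewrite oppr_eq0; apply: contraTneq s0 => ->; rewrite ltxx.
rewrite !mulf_neq0 ?evXn ?expf_neq0 //.
  by apply: contraTneq s0 => /(congr1 Re); rewrite RecD RecN => h; rewrite -leNgt; lra.
apply: contraTneq s0 => /(congr1 Re); rewrite RecD !RecN.
by case: (s) => a b /= h; rewrite -leNgt; lra.
Qed.

(** Conjugation reduces nonreal zeros to the upper half-plane; positive coefficients exclude
    nonnegative real zeros. *)
Lemma hurwitz_segment_had n m j f g : (0 < m)%N -> (j + m <= n)%N ->
  hurwitz n f -> hurwitz m g -> hurwitz m (segment_had m j f g).
Proof.
move=> m0 jmn fH gH; have [[sf fpos] _] := fH; have [[sg gpos] _] := gH.
set F := segment_had m j f g.
have Fpos i : (i <= m)%N -> 0 < F`_i.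
  move=> im; rewrite coef_poly ltnS im mulr_gt0 ?gpos // fpos //.
  by rewrite (leq_trans _ jmn) // leq_add2l.
split; first by split; [exact: size_poly|exact: Fpos].
move=> z /eqP Fz; rewrite ltNge; apply/negP => z0.
have [z1|z1|z1] := ltgtP 0 (Im z).
- by have /eqP := segment_had_upper_root m0 jmn fH gH z0 z1; apply.
- have c0 : 0 <= Re (conjc z) by case: (z) z0.
  have c1 : 0 < Im (conjc z) by case: (z) z1 => a b /=; rewrite oppr_gt0.
  have /eqP := segment_had_upper_root m0 jmn fH gH c0 c1; apply.
  by rewrite ev_conj [ev _ _]Fz conjc0.
have zE : z = real_complex R (Re z) by apply: complex_eqP.
have Fr : F.[Re z] = 0.
  by apply: (@complexI R); rewrite rmorph0 -ev_real -zE.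
have F0 : F != 0 by apply: contraTneq (Fpos 0%N isT) => ->; rewrite coef0 ltxx.
have r0 h : Re z <= 0 := @nonneg_coef_root_le0 R F (Re z) h F0 Fr.
have rz : Re z = 0.
  apply/le_anti; rewrite z0 andbT; apply: r0 => i.
  have [/Fpos/ltW//|mi] := leqP i m; by rewrite nth_default // (leq_trans (size_poly _ _)).
by have := Fpos 0%N isT; rewrite -horner_coef0 -[X in F.[X]]rz Fr ltxx.
Qed.
End SegmentProduct.

Local Open Scope classical_set_scope.

Theorem theorem4 (R : realType) (n m : nat) (f g : {poly R})
  (m_gt0 : (0 < m)%N) (n_gt0 : (0 < n)%N) (le_mn : (m <= n)%N)
  (fH : hurwitz n f) (gF : has_hadamard_factorization m g) :
  gen_hadamard n m f g `<=` hurwitz m.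
Proof.
move=> _ [j /= jnm <-]; case: gF => g1 [g2 [g1H g2H gE]].
have jmn : (j + m <= n)%N by rewrite addnC -leq_subRL.
apply: hurwitz_segment_had jmn fH _ => //.
(* The ordinary Hadamard product is the segment product with n = m and j = 0. *)
rewrite gE; exact: (@hurwitz_segment_had _ m m 0 _ _ m_gt0 (leqnn m) g1H g2H).
Qed.
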